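(* Let $n\ge 3$. (a) The inverse stereographic projection $\sigma_{\mathrm N}^{-1}$ from $(\mathbb{R}^n ,ds^2)$ into $(\mathbb{S}^{n}\setminus\{\mathrm N\} , ds^2)$, where $\mathrm N$ is the north pole, is a biharmonic map if and only if $n=4$. (b) The identity map from $(\mathbb{B}^{n}, ds^2)$ into $(\mathbb{B}^{n},\tfrac{4}{(1 - |x|^2)^2} ds^2)$, where $\mathbb{B}^n$ is the open unit ball of $\mathbb{R}^n$, is a biharmonic map if and only if $n=4$. (c) Furthermore, in either case, the biharmonic map (obtained for $n=4$) is not a biharmonic morphism.
   Context: $ds^2$ denotes the Euclidean metric (and the induced standard round metric on the unit sphere $\mathbb S^n\subset\mathbb R^{n+1}$). Under $\sigma_{\mathrm N}^{-1}$ the round metric pulls back to $\frac{4}{(1+|x|^2)^2}ds^2$ on $\mathbb R^n$. For a smooth map $\phi:(M,g)\to(N,h)$ of Riemannian manifolds, $\tau(\phi)=\mathrm{trace}_g\nabla d\phi$ is the tension field, and $\phi$ is biharmonic if $\tau^2(\phi)=-\Delta^\phi\tau(\phi)-\mathrm{trace}_gR^N(d\phi,\tau(\phi))d\phi=0$, with $\Delta^\phi=-\mathrm{trace}_g(\nabla^\phi\nabla^\phi-\nabla^\phi_{\nabla})$ and $R(X,Y)=[\nabla_X,\nabla_Y]-\nabla_{[X,Y]}$. A function $f$ is biharmonic if $\Delta^2f=0$. A continuous map $\phi:(M,g)\to(N,h)$ is a biharmonic morphism if for every biharmonic function $f:U\subset N\to\mathbb R$ ($U$ open) with $\phi^{-1}(U)\ne\emptyset$,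 the function $f\circ\phi$ is biharmonic on $\phi^{-1}(U)$. *)

(* Defs.v *)
From HB Require Import structures.
From mathcomp Require Import all_boot all_order all_algebra.
From mathcomp Require Import all_classical all_reals all_analysis.
From mathcomp Require Import ring lra.

Set Implicit Arguments.
Unset Strict Implicit.
Unset Printing Implicit Defensive.

Import Order.TTheory GRing.Theory Num.Theory.
Import numFieldNormedType.Exports.

Local Open Scope classical_set_scope.
Local Open Scope ring_scope.

(* `|x| is the sup norm on row vectors, so Euclidean lengths go through dot. *)
Definition dot (R : realType) (n : nat) (u v : 'rV[R]_n) : R :=
  \sum_i u 0 i * v 0 i.

Definition frame (R : realType) (n : nat) (i : 'I_n) : 'rV[R]_n := delta_mx 0 i.

(* C^k on an open set D, by iterated partial derivatives. *)
Fixpoint Ck (R : realType) (n : nat) (W : normedModType R) (D : set 'rV[R]_n)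
    (k : nat) (f : 'rV[R]_n -> W) : Prop :=
  (forall x, D x -> {for x, continuous f}) /\
  (if k is k'.+1 then
     forall i : 'I_n, (forall x, D x -> derivable f x (frame R i)) /\
                      Ck D k' ('D_(frame R i) f)
   else True).

Definition smooth_on (R : realType) (n : nat) (W : normedModType R)
    (D : set 'rV[R]_n) (f : 'rV[R]_n -> W) : Prop := forall k, Ck D k f.

Section metric.
Variables (R : realType) (n : nat) (g : 'rV[R]_n -> 'M[R]_n).
Implicit Types (x u v w : 'rV[R]_n) (X Y Z : 'rV[R]_n -> 'rV[R]_n).

Definition christoffel x (k i j : 'I_n) : R :=
  2^-1 * \sum_l invmx (g x) k l *
    ('D_(frame R i) (fun y => g y j l) x + 'D_(frame R j) (fun y => g y i l) x
     - 'D_(frame R l) (fun y => g y i j) x).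

Definition Gamma x u v : 'rV[R]_n :=
  \row_k \sum_i \sum_j christoffel x k i j * u 0 i * v 0 j.

Definition nabla X Y : 'rV[R]_n -> 'rV[R]_n :=
  fun x => 'D_(X x) Y x + Gamma x (X x) (Y x).

Definition lie_bracket X Y : 'rV[R]_n -> 'rV[R]_n :=
  fun x => 'D_(X x) Y x - 'D_(Y x) X x.

Definition curvature X Y Z : 'rV[R]_n -> 'rV[R]_n := fun x =>
  nabla X (nabla Y Z) x - nabla Y (nabla X Z) x - nabla (lie_bracket X Y) Z x.

(* The curvature is tensorial, so vectors at x may be extended to constant
   fields. *)
Definition curvature_at x u v w : 'rV[R]_n :=
  curvature (cst u) (cst v) (cst w) x.

Definition trace_g (V : lmodType R) x (B : 'I_n -> 'I_n -> V) : V :=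
  \sum_i \sum_j invmx (g x) i j *: B i j.

(* Same sign as the rough Laplacian below: minus the trace of the Hessian. *)
Definition laplacian (f : 'rV[R]_n -> R) : 'rV[R]_n -> R := fun x =>
  - trace_g x (fun i j =>
      ('D_(frame R i) ('D_(frame R j) f) x
       - 'D_(nabla (cst (frame R i)) (cst (frame R j)) x) f x : R^o)).

End metric.

Section maps.
Variables (R : realType) (m n : nat).
Variables (g : 'rV[R]_m -> 'M[R]_m) (h : 'rV[R]_n -> 'M[R]_n).
Variable phi : 'rV[R]_m -> 'rV[R]_n.
Implicit Types (X Y : 'rV[R]_m -> 'rV[R]_m) (V : 'rV[R]_m -> 'rV[R]_n).

(* The connection of phi^*TN; a section V is given by its components. *)
Definition pnabla X V : 'rV[R]_m -> 'rV[R]_n := fun x =>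
  'D_(X x) V x + Gamma h (phi x) ('D_(X x) phi x) (V x).

Definition dmap X : 'rV[R]_m -> 'rV[R]_n := fun x => 'D_(X x) phi x.

Definition nabla_dmap X Y : 'rV[R]_m -> 'rV[R]_n := fun x =>
  pnabla X (dmap Y) x - dmap (nabla g X Y) x.

Definition tension : 'rV[R]_m -> 'rV[R]_n := fun x =>
  trace_g g x (fun i j => nabla_dmap (cst (frame R i)) (cst (frame R j)) x).

Definition rough_laplacian V : 'rV[R]_m -> 'rV[R]_n := fun x =>
  - trace_g g x (fun i j =>
      pnabla (cst (frame R i)) (pnabla (cst (frame R j)) V) x
      - pnabla (nabla g (cst (frame R i)) (cst (frame R j))) V x).

Definition bitension : 'rV[R]_m -> 'rV[R]_n := fun x =>
  - rough_laplacian tension x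
  - trace_g g x (fun i j =>
      curvature_at h (phi x)
        ('D_(frame R i) phi x) (tension x) ('D_(frame R j) phi x)).

End maps.

(* An n-dimensional Riemannian manifold whose points lie in R^k and which is
   covered by a single chart: coord maps carrier onto the open set dom of R^n,
   with inverse param, and metric is the metric tensor in these coordinates.
   Values outside carrier and dom are irrelevant. *)
Record riem (R : realType) (k n : nat) := Riem {
  carrier : set 'rV[R]_k;
  dom : set 'rV[R]_n;
  coord : 'rV[R]_k -> 'rV[R]_n;
  param : 'rV[R]_n -> 'rV[R]_k;
  metric : 'rV[R]_n -> 'M[R]_n }.

Section biharmonicity.
Variables (R : realType) (k m l n : nat) (M : riem R k m) (N : riem R l n).

Definition in_coords (phi : 'rV[R]_k -> 'rV[R]_l) : 'rV[R]_m -> 'rV[R]_n :=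
  fun x => coord N (phi (param M x)).

Definition biharmonic_map (phi : 'rV[R]_k -> 'rV[R]_l) : Prop :=
  [/\ phi @` carrier M `<=` carrier N,
      smooth_on (dom M) (in_coords phi) &
      forall x, dom M x ->
        bitension (metric M) (metric N) (in_coords phi) x = 0].

Definition open_in (U : set 'rV[R]_k) : Prop :=
  exists2 O : set 'rV[R]_k, open O & U = carrier M `&` O.

Definition biharmonic_fun (U : set 'rV[R]_k) (f : 'rV[R]_k -> R) : Prop :=
  let D := dom M `&` param M @^-1` U in
  let fM : 'rV[R]_m -> R := f \o param M in
  smooth_on D fM /\
  forall x, D x -> laplacian (metric M) (laplacian (metric M) fM) x = 0.

End biharmonicity.

Definition biharmonic_morphism (R : realType) (k m l n : nat)
    (M : riem R k m) (N : riem R l n) (phi : 'rV[R]_k -> 'rV[R]_l) : Prop :=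
  [/\ phi @` carrier M `<=` carrier N,
      {within carrier M, continuous phi} &
      forall (U : set 'rV[R]_l) (f : 'rV[R]_l -> R),
        open_in N U -> carrier M `&` phi @^-1` U !=set0 ->
        biharmonic_fun N U f ->
        biharmonic_fun M (carrier M `&` phi @^-1` U) (f \o phi)].

Definition riem_domain (R : realType) (n : nat) (D : set 'rV[R]_n)
    (g : 'rV[R]_n -> 'M[R]_n) : riem R n n :=
  {| carrier := D; dom := D; coord := id; param := id; metric := g |}.

Definition euclidean_space (R : realType) (n : nat) : riem R n n :=
  riem_domain setT (cst 1%:M).

Definition unit_ball (R : realType) (n : nat) : set 'rV[R]_n :=
  [set x | dot x x < 1].

Definition euclidean_ball (R : realType) (n : nat) : riem R n n :=
  riem_domain (@unit_ball R n) (cst 1%:M).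

Definition hyperbolic_ball (R : realType) (n : nat) : riem R n n :=
  riem_domain (@unit_ball R n) (fun x => (4 / (1 - dot x x) ^+ 2)%:M).

Definition north (R : realType) (n : nat) : 'rV[R]_(n + 1) := row_mx 0 1%:M.

Definition stereo (R : realType) (n : nat) (y : 'rV[R]_(n + 1)) : 'rV[R]_n :=
  (1 - rsubmx y 0 0)^-1 *: lsubmx y.

Definition inv_stereo (R : realType) (n : nat) (x : 'rV[R]_n) :
    'rV[R]_(n + 1) :=
  (1 + dot x x)^-1 *: row_mx (2 *: x) (dot x x - 1)%:M.

Definition induced_metric (R : realType) (k n : nat)
    (psi : 'rV[R]_n -> 'rV[R]_k) : 'rV[R]_n -> 'M[R]_n :=
  fun x => \matrix_(i, j) dot ('D_(frame R i) psi x) ('D_(frame R j) psi x).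

Definition punctured_sphere (R : realType) (n : nat) : riem R (n + 1) n :=
  {| carrier := [set y | dot y y = 1] `\ north R n;
     dom := setT;
     coord := @stereo R n;
     param := @inv_stereo R n;
     metric := induced_metric (@inv_stereo R n) |}.

Section stereographic_facts.
Variables (R : realType) (n : nat).
Implicit Types (x : 'rV[R]_n) (y : 'rV[R]_(n + 1)).

Lemma dot_ge0 m (u : 'rV[R]_m) : 0 <= dot u u.
Proof. by apply: sumr_ge0 => i _; rewrite -expr2 sqr_ge0. Qed.

Lemma dot_row y : dot y y = dot (lsubmx y) (lsubmx y) + rsubmx y 0 0 ^+ 2.
Proof.
rewrite /dot big_split_ord /= big_ord1 expr2; congr (_ + _).
  by apply: eq_bigr => i _; rewrite !mxE.
by rewrite !mxE.
Qed.

Lemma dotZ m a (u : 'rV[R]_m) : dot (a *: u) (a *: u) = a ^+ 2 * dot u u.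
Proof.
by rewrite /dot mulr_sumr; apply: eq_bigr => i _; rewrite !mxE; ring.
Qed.

Lemma inv_stereo_l x : lsubmx (inv_stereo x) = (1 + dot x x)^-1 *: (2 *: x).
Proof. by rewrite linearZ /= row_mxKl. Qed.

Lemma inv_stereo_r x :
  rsubmx (inv_stereo x) 0 0 = (dot x x - 1) / (1 + dot x x).
Proof. by rewrite linearZ /= row_mxKr !mxE eqxx mulr1n mulrC. Qed.

Lemma stereoK x : stereo (inv_stereo x) = x.
Proof.
have := dot_ge0 x => d0; rewrite /stereo inv_stereo_l inv_stereo_r !scalerA.
rewrite (_ : _ * _ * 2 = 1) ?scale1r//.
by field; do ?[apply/andP; split]; apply: lt0r_neq0; lra.
Qed.

Lemma inv_stereo_carrier x : carrier (punctured_sphere R n) (inv_stereo x).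
Proof.
have := dot_ge0 x => d0; split=> [|E] /=.
  rewrite dot_row inv_stereo_l inv_stereo_r !dotZ.
  by field; apply: lt0r_neq0; lra.
have := inv_stereo_r x; rewrite E row_mxKr mxE eqxx mulr1n.
move/(congr1 (fun z => z * (1 + dot x x))).
by rewrite divfK; [lra | apply: lt0r_neq0; lra].
Qed.

Lemma inv_stereoK y :
  carrier (punctured_sphere R n) y -> inv_stereo (stereo y) = y.
Proof.
move=> [/= y1 yN]; have := y1; rewrite dot_row => E.
have t1 : 1 - rsubmx y 0 0 != 0.
  apply/eqP => t1; apply: yN; move: E.
  have -> : rsubmx y 0 0 = 1 by lra.
  move=> E; have {}E : dot (lsubmx y) (lsubmx y) = 0 by lra.
  rewrite -(hsubmxK y) /north; congr row_mx.
    apply/rowP => i; rewrite [RHS]mxE; apply/eqP; rewrite -sqrf_eq0 expr2.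
    apply/eqP; apply: (psumr_eq0P _ E) => // j _.
    by rewrite -expr2 sqr_ge0.
  by apply/rowP => i; rewrite ord1 [RHS]mxE eqxx mulr1n; lra.
set t := rsubmx y 0 0 in E t1.
have D : dot (stereo y) (stereo y) = (1 + t) / (1 - t).
  rewrite /stereo dotZ -/t (_ : dot _ _ = 1 - t ^+ 2); last lra.
  by field.
rewrite /inv_stereo D -[RHS]hsubmxK scale_row_mx; congr row_mx.
  rewrite /stereo !scalerA -/t (_ : _ * 2 * _ = 1) ?scale1r//.
  by field; apply/andP; split=> //; apply/eqP; lra.
apply/rowP => i; rewrite ord1 !mxE eqxx mulr1n -/t.
transitivity t; last by rewrite /t !mxE.
by field; apply/andP; split=> //; apply/eqP; lra.
Qed.

End stereographic_facts.

(* Main.v *)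
(** For a constant [e], the metric [c / (1 + e |x|^2)^2 ds^2] has constant
    curvature [4 e / c]; [c = 4] with [e = 1] and [e = - 1] gives the round sphere
    in stereographic coordinates and the hyperbolic ball, and [c = 1], [e = 0]
    gives [ds^2].  In these coordinates both maps are the identity.  With
    [a = 1 / (1 + e |x|^2)], the Christoffel symbols of the metric give the
    tension field [2 e (n - 2) a x], and then the bitension field
    [8 e^2 (n - 2) (n - 4) a^2 (2 a - 1) x], which vanishes identically only for
    [n = 4] when [n >= 3] and [e] is not zero.

    For [n = 4] and [c = 4], conformal covariance of the Paneitz operator gives
    [Delta^2 f = 2 e (4 a^2)^2 Delta_h f] for every [f] biharmonic for the curved
    metric [h]; hence any such [f] that is not harmonic defeats the morphism
    property.  The function [e |x|^2 + 2 ln (1 + e |x|^2)] has constant nonzero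
    [Delta_h], and Euclidean bilaplacian [- 192 e^2] at the origin. *)

Require Import Defs.
From mathcomp Require Import all_boot all_order all_algebra.
From mathcomp Require Import all_classical all_reals all_analysis.
From mathcomp Require Import ring lra.

Set Implicit Arguments.
Unset Strict Implicit.
Unset Printing Implicit Defensive.

Import Order.TTheory GRing.Theory Num.Theory.
Import numFieldNormedType.Exports.

Local Open Scope classical_set_scope.
Local Open Scope ring_scope.

(** * Calculus rules for directional derivatives *)

Section directional_derivatives.
Variables (R : realType) (V : normedModType R).
Implicit Types (x v : V) (f g : V -> R).

(** Along [t *: v + x] the difference quotients of both sides coincide, so the one-variable chain
    rule becomes available for [f] that is only derivable in the direction [v]. *)
Lemma is_derive_line (W : normedModType R) (f : V -> W) x v df :
  is_derive x v f df <-> is_derive (0 : R) 1 (fun t => f (t *: v + x)) df.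
Proof.
have E : 'D_1 (fun t : R => f (t *: v + x)) 0 = 'D_v f x.
  rewrite /derive; congr (lim (_ @ 0^')); apply/funext => t /=.
  by rewrite addr0 scale0r add0r [_%:A]mulr1.
by split=> -[/(derivable1P f x v) d <-]; split=> //;
  exact: (derivable1P f x v).2.
Qed.

Lemma is_derive_chain (phi : R -> R) f x v a df :
  is_derive x v f df -> is_derive (f x) 1 phi a ->
  is_derive x v (fun y => phi (f y)) (a * df).
Proof.
move=> /is_derive_line Hf Hphi; apply/is_derive_line.
by apply: (@is_derive1_comp R phi); rewrite //= scale0r add0r.
Qed.

Lemma is_derive_addf (W : normedModType R) (f g : V -> W) x v df dg :
  is_derive x v f df -> is_derive x v g dg ->
  is_derive x v (fun y => f y + g y) (df + dg).
Proof. exact: is_deriveD. Qed.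

Lemma is_derive_cmulf f c x v df :
  is_derive x v f df -> is_derive x v (fun y => c * f y) (c * df).
Proof. exact: is_deriveZ. Qed.

Lemma is_derive_mulf f g x v df dg :
  is_derive x v f df -> is_derive x v g dg ->
  is_derive x v (fun y => f y * g y) (df * g x + f x * dg).
Proof.
move=> Hf Hg; apply: is_derive_eq (is_deriveM Hf Hg) _.
by rewrite /GRing.scale /=; ring.
Qed.

Lemma is_derive_invf f x v df :
  is_derive x v f df -> f x != 0 ->
  is_derive x v (fun y => (f y)^-1) (- df * (f x)^-1 ^+ 2).
Proof.
move=> [D <-] f0; split; first exact: derivableV.
by rewrite deriveV // /GRing.scale /= exprVn; ring.
Qed.

Lemma is_derive_row k (f : V -> 'rV[R]_k) x v (df : 'rV[R]_k) :
  (forall j, is_derive x v (fun y => f y 0 j) (df 0 j)) -> is_derive x v f df.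
Proof.
move=> H; have D : derivable f x v.
  by apply/derivable_mxP => i j; rewrite ord1; case: (H j).
apply: DeriveDef => //; rewrite derive_mx //; apply/rowP => j.
by rewrite !mxE; case: (H j).
Qed.

Lemma is_derive_scale k f (g : V -> 'rV[R]_k) x v df dg :
  is_derive x v f df -> is_derive x v g dg ->
  is_derive x v (fun y => f y *: g y) (df *: g x + f x *: dg).
Proof.
move=> Hf [Dg <-]; apply: is_derive_row => j.
have -> : (fun y => (f y *: g y) 0 j) = (fun y => f y * g y 0 j).
  by apply/funext => y; rewrite !mxE.
apply: is_derive_eq; first apply: is_derive_mulf Hf _.
  by apply: derivableP; move/derivable_mxP : Dg; apply.
by rewrite derive_mx // !mxE.
Qed.

Lemma is_derive_dot k (f g : V -> 'rV[R]_k) x v df dg :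
  is_derive x v f df -> is_derive x v g dg ->
  is_derive x v (fun y => dot (f y) (g y)) (dot df (g x) + dot (f x) dg).
Proof.
move=> [Df <-] [Dg <-]; rewrite -big_split /=.
have -> : (fun y => dot (f y) (g y)) = \sum_i (fun y => f y 0 i * g y 0 i).
  by apply/funext => y; rewrite fct_sumE.
apply: is_derive_sum => i; rewrite !derive_mx // !mxE.
by apply: is_derive_mulf; apply: derivableP;
   [move/derivable_mxP: Df | move/derivable_mxP: Dg]; apply.
Qed.

End directional_derivatives.

(** * The Euclidean inner product and the derivative of the squared length *)

Section euclidean.
Variables (R : realType) (n : nat).
Implicit Types u v w x : 'rV[R]_n.

Lemma is_derive_coord x v i :
  is_derive x v (fun y => y 0 i) (v 0 i).
Proof.
have /derivable_mxP D := @derivable_id _ 'rV[R]_n x v.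
by apply: DeriveDef; [exact: D | rewrite -{2}(derive_id x v) derive_mx ?mxE].
Qed.

Lemma dotC u v : dot u v = dot v u.
Proof. by apply: eq_bigr => i _; rewrite mulrC. Qed.

Lemma dotDr u v w : dot u (v + w) = dot u v + dot u w.
Proof. by rewrite -big_split; apply: eq_bigr => i _; rewrite /= mxE mulrDr. Qed.

Lemma dotZr c u v : dot u (c *: v) = c * dot u v.
Proof. by rewrite mulr_sumr; apply: eq_bigr => i _; rewrite /= mxE mulrCA. Qed.

Lemma dotNr u v : dot u (- v) = - dot u v.
Proof. by rewrite -scaleN1r dotZr mulN1r. Qed.

Lemma dot0r u : dot u 0 = 0.
Proof. by rewrite -(scale0r 0) dotZr mul0r. Qed.

Lemma dotDl u v w : dot (u + v) w = dot u w + dot v w.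
Proof. by rewrite dotC dotDr !(dotC w). Qed.

Lemma dotZl c u v : dot (c *: u) v = c * dot u v.
Proof. by rewrite dotC dotZr dotC. Qed.

Lemma dotNl u v : dot (- u) v = - dot u v.
Proof. by rewrite dotC dotNr dotC. Qed.

Lemma dot_framer u i : dot u (frame R i) = u 0 i.
Proof.
rewrite /dot (bigD1 i) //= big1 => [|j ji]; rewrite !mxE !eqxx ?mulr1 ?addr0 //.
by rewrite (negPf ji) mulr0.
Qed.

Lemma sum_frame u : \sum_i u 0 i *: frame R i = u.
Proof. by rewrite -row_sum_delta. Qed.

Lemma is_derive_sqn x v : is_derive x v (fun y => dot y y) (2 * dot x v).
Proof.
apply: is_derive_eq; first exact:
  is_derive_dot (is_derive_id _ _) (is_derive_id _ _).
by rewrite (dotC v); ring.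
Qed.

Lemma differentiable_sqn x : differentiable (fun y : 'rV[R]_n => dot y y) x.
Proof.
have -> : (fun y : 'rV[R]_n => dot y y) =
    \sum_i (fun y : 'rV[R]_n => y 0 i * y 0 i).
  by apply/funext => z; rewrite fct_sumE.
by apply: differentiable_sum => i; apply: differentiableM;
   exact: differentiable_coord.
Qed.

Lemma dot_frame i : dot (frame R i : 'rV[R]_n) (frame R i) = 1.
Proof. by rewrite dot_framer mxE !eqxx. Qed.

End euclidean.

(** * The conformally flat metrics of constant curvature and their Christoffel symbols *)

Section space_form.
Variables (R : realType) (n : nat).
Implicit Types (c e : R) (x u v w : 'rV[R]_n).

Definition conf e x : R := (1 + e * dot x x)^-1.

(** This is the whole space for [e >= 0] and the open unit ball for [e = - 1], so both targets are
    covered at once. *)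
Definition space_form_dom e : set 'rV[R]_n := [set x | 0 < 1 + e * dot x x].

Definition space_form c e x : 'M[R]_n := (c * conf e x ^+ 2)%:M.

Lemma conf_neq0 e x : space_form_dom e x -> conf e x != 0.
Proof. by move=> Dx; rewrite invr_eq0 gt_eqF. Qed.

Lemma open_space_form_dom e : open (space_form_dom e).
Proof.
have C : continuous (fun x : 'rV[R]_n => 1 + e * dot x x).
  have -> : (fun x : 'rV[R]_n => 1 + e * dot x x) =
      cst 1 + cst e * (fun x => dot x x) by [].
  move=> x; apply: continuousD; first exact: cst_continuous.
  apply: continuousM; first exact: cst_continuous.
  exact/differentiable_continuous/differentiable_sqn.
apply: (@open_comp _ _ (fun x => 1 + e * dot x x) [set t | 0 < t]).
  by move=> x _; exact: C.
exact: open_gt.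
Qed.

Lemma near_space_form_dom e x :
  space_form_dom e x -> \forall y \near x, space_form_dom e y.
Proof.
by move=> Dx; apply: open_nbhs_nbhs; split=> //; exact: open_space_form_dom. Qed.

Lemma is_derive_affine (s e : R) : is_derive s 1 (fun t => 1 + e * t) e.
Proof.
apply: is_derive_eq (is_derive_addf (is_derive_cst (1 : R) s 1)
  (is_derive_cmulf e (is_derive_id s 1))) _.
by rewrite mulr1 add0r.
Qed.

Lemma is_derive_inv (s : R) e : 0 < 1 + e * s ->
  is_derive s 1 (fun t => (1 + e * t)^-1) (- e * (1 + e * s)^-1 ^+ 2).
Proof.
by move=> h; apply: is_derive_invf (is_derive_affine s e) _; rewrite gt_eqF.
Qed.

Lemma is_derive_conf e x v : space_form_dom e x ->
  is_derive x v (conf e) (- 2 * e * conf e x ^+ 2 * dot x v).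
Proof.
move=> Dx.
apply: is_derive_eq (is_derive_chain (is_derive_sqn x v) (is_derive_inv Dx)) _.
by rewrite /conf; ring.
Qed.

Lemma sum_delta (F : 'I_n -> R) k : \sum_j (j == k)%:R * F j = F k.
Proof.
rewrite (bigD1 k) //= big1 => [|j /negPf->]; last by rewrite mul0r.
by rewrite eqxx mul1r addr0.
Qed.

Lemma is_derive_space_form c e x v (i j : 'I_n) : space_form_dom e x ->
  is_derive x v (fun y => space_form c e y i j)
    ((i == j)%:R * (- 4 * c * e * conf e x ^+ 3 * dot x v)).
Proof.
move=> Dx.
have -> : (fun y => space_form c e y i j) =
    (fun y => (i == j)%:R * c * (conf e y * conf e y)).
  by apply/funext => y; rewrite !mxE -mulr_natl; ring.
have H := is_derive_conf v Dx.
by apply: is_derive_eq (is_derive_cmulf _ (is_derive_mulf H H)) _; ring.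
Qed.

(** The metric is [exp (2 rho) ds^2] with [rho = ln conf] up to a constant, and the gradient of
    [rho] is [- 2 e conf x]; the bracket is the usual conformal change of the flat connection. The
    constant [c] cancels against the inverse metric. *)
Lemma christoffel_space_form c e x (k i j : 'I_n) :
    c != 0 -> space_form_dom e x ->
  christoffel (space_form c e) x k i j = - 2 * e * conf e x *
    (x 0 i * (j == k)%:R + x 0 j * (i == k)%:R - x 0 k * (i == j)%:R).
Proof.
move=> c0 Dx; have a0 := conf_neq0 Dx; rewrite /christoffel invmx_scalar.
under eq_bigr => l _ do rewrite mxE -mulr_natl eq_sym -mulrA.
rewrite sum_delta.
have E l m v := @derive_val _ _ _ _ _ _ _ (is_derive_space_form c v l m Dx).
rewrite !E !dot_framer; field.
by rewrite c0 a0.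
Qed.

Lemma Gamma_space_form c e x u v : c != 0 -> space_form_dom e x ->
  Gamma (space_form c e) x u v =
    (- 2 * e * conf e x) *: (dot x u *: v + dot x v *: u - dot u v *: x).
Proof.
move=> c0 Dx; apply/rowP => k; rewrite !mxE.
under eq_bigr => i _ do under eq_bigr => j _ do rewrite christoffel_space_form //.
set b := - 2 * e * conf e x.
transitivity (\sum_i b * (x 0 i * u 0 i * v 0 k +
   (i == k)%:R * (dot x v * u 0 i) - x 0 k * (u 0 i * v 0 i))).
  apply: eq_bigr => i _.
  (* Writing [v 0 k] and [u 0 i * v 0 i] as Kronecker sums over [j] turns both sides into sums over
     [j], which then agree term by term. *)
  rewrite -(sum_delta (v 0) k) -(sum_delta (fun j => u 0 i * v 0 j) i).
  rewrite /dot mulr_suml !mulr_sumr -!big_split -sumrB mulr_sumr /=.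
  by apply: eq_bigr => j _; rewrite (eq_sym j i); ring.
rewrite -mulr_sumr sumrB big_split /= -mulr_suml -mulr_sumr sum_delta.
by rewrite -!/(dot _ _) [x 0 k * _]mulrC.
Qed.

End space_form.

(** * The connection on constant fields and along the identity map *)

Section connection.
Variables (R : realType) (n : nat).
Implicit Types (x u v w : 'rV[R]_n) (X Y V : 'rV[R]_n -> 'rV[R]_n).
Implicit Types (g h : 'rV[R]_n -> 'M[R]_n).

Lemma nabla_cst g x u v : nabla g (cst u) (cst v) x = Gamma g x u v.
Proof. by rewrite /nabla derive_cst add0r. Qed.

Lemma Gamma0l g x v : Gamma g x 0 v = 0.
Proof.
apply/rowP => k; rewrite !mxE big1 // => i _; rewrite big1 // => j _.
by rewrite mxE mulr0 mul0r.
Qed.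

Lemma nabla0 g X V x : X x = 0 -> nabla g X V x = 0.
Proof. by move=> X0; rewrite /nabla X0 derive0 Gamma0l addr0. Qed.

Lemma pnabla_id h : pnabla h id = nabla h.
Proof.
by apply/funext => X; apply/funext => V; apply/funext => x;
   rewrite /pnabla derive_id.
Qed.

Lemma dmap_id X : dmap id X = X.
Proof. by apply/funext => x; rewrite /dmap derive_id. Qed.

End connection.

(** * Tension and bitension of the identity from the flat metric to a space form *)

Section bitension_of_identity.
Variables (R : realType) (n : nat) (c e : R).
Hypothesis c0 : c != 0.
Implicit Types (x y u v w : 'rV[R]_n).

(** The flat metric is taken as the member [c = 1], [e = 0] of the family, so the same Christoffel
    and trace formulas serve the source and the target. *)
Let g := @space_form R n 1 0.
Let h := @space_form R n c e.

(** Derivatives are local and the domain is open; hence closed formulas that hold only on the domain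
    may still be differentiated there. *)
Lemma derive_dom_eq (W : normedModType R) (f1 f2 : 'rV[R]_n -> W) x v :
  (forall y, space_form_dom e y -> f1 y = f2 y) -> space_form_dom e x ->
  'D_v f1 x = 'D_v f2 x.
Proof.
move=> H Dx; apply: near_eq_derive.
by apply: filterS (near_space_form_dom Dx).
Qed.

Lemma trace_space_form (V : lmodType R) d k x (B : 'I_n -> 'I_n -> V) :
  trace_g (space_form d k) x B = (d * conf k x ^+ 2)^-1 *: \sum_i B i i.
Proof.
rewrite /trace_g invmx_scalar scaler_sumr; apply: eq_bigr => i _.
rewrite (bigD1 i) //= big1 => [|j /negPf ji]; rewrite mxE; last first.
  by rewrite eq_sym ji mulr0n scale0r.
by rewrite eqxx mulr1n addr0.
Qed.

Lemma trace_flat (V : lmodType R) x (B : 'I_n -> 'I_n -> V) :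
  trace_g g x B = \sum_i B i i.
Proof.
by rewrite trace_space_form /conf mul0r addr0 !invr1 expr1n mulr1 invr1 scale1r.
Qed.

Lemma nabla_flat x u v : nabla g (cst u) (cst v) x = 0.
Proof.
rewrite nabla_cst Gamma_space_form ?oner_neq0 //.
  by rewrite mulr0 mul0r scale0r.
by rewrite /space_form_dom /= mul0r addr0 ltr01.
Qed.

Definition identity_tension x : 'rV[R]_n := (2 * e * (n%:R - 2) * conf e x) *: x.

Lemma tension_identity x : space_form_dom e x ->
  tension g h id x = identity_tension x.
Proof.
move=> Dx; rewrite /tension trace_flat.
under eq_bigr => i _.
  rewrite /nabla_dmap pnabla_id !dmap_id nabla_flat subr0 nabla_cst.
  rewrite Gamma_space_form // dot_frame !dot_framer scale1r -mulr2n.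
  over.
rewrite -scaler_sumr sumrB sumrMnl sum_frame sumr_const card_ord.
rewrite -[x *+ 2]scaler_nat -[x *+ n]scaler_nat -scalerBl scalerA; congr (_ *: _).
by ring.
Qed.

(** Closed form of the covariant derivative of the tension field along [u], stated separately so
    that it can be differentiated once more. The identity [e |x|^2 conf = 1 - conf] has been used to
    eliminate [|x|^2]. *)
Definition nabla_tension u x : 'rV[R]_n :=
  (2 * e * (n%:R - 2) * (2 * conf e x ^+ 2 - conf e x)) *: u
  + (- 4 * e ^+ 2 * (n%:R - 2) * conf e x ^+ 2 * dot x u) *: x.

Lemma nabla_tension_identity u x : space_form_dom e x ->
  nabla h (cst u) (tension g h id) x = nabla_tension u x.
Proof.
move=> Dx; rewrite /nabla (derive_dom_eq _ tension_identity) //.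
have Ha := is_derive_conf u Dx.
have [_ ->] := is_derive_scale (is_derive_cmulf (2 * e * (n%:R - 2)) Ha)
  (is_derive_id x u).
rewrite Gamma_space_form // tension_identity //.
rewrite /identity_tension /nabla_tension !dotZr (dotC u x).
apply/rowP => k; rewrite !mxE; rewrite /conf; field.
by rewrite gt_eqF.
Qed.

Lemma nabla2_tension_identity u x : space_form_dom e x ->
  nabla h (cst u) (nabla h (cst u) (tension g h id)) x =
  (2 * e * (n%:R - 2)) *:
    ((e * (8 * conf e x ^+ 2 - 20 * conf e x ^+ 3) * dot x u) *: u
     + (8 * e ^+ 2 * conf e x ^+ 3 * dot x u ^+ 2
        + 4 * e * (conf e x ^+ 3 - conf e x ^+ 2) * dot u u) *: x).
Proof.
move=> Dx; rewrite /nabla -/(nabla h (cst u) (tension g h id)).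
rewrite (derive_dom_eq _ (nabla_tension_identity u)) //.
rewrite -/(nabla h (cst u) (tension g h id) x) nabla_tension_identity //.
have Ha := is_derive_conf u Dx.
have Hx := is_derive_id x u.
have Hn : is_derive x u (nabla_tension u) (
    (2 * e * (n%:R - 2) * ((4 * conf e x - 1) *
       (- 2 * e * conf e x ^+ 2 * dot x u))) *: u
    + ((- 4 * e ^+ 2 * (n%:R - 2) * (conf e x ^+ 2 * dot u u
         - 4 * e * conf e x ^+ 3 * dot x u ^+ 2)) *: x
       + (- 4 * e ^+ 2 * (n%:R - 2) * conf e x ^+ 2 * dot x u) *: u)).
  have Hd : is_derive x u (fun y => dot y u) (dot u u).
    apply: is_derive_eq (is_derive_dot Hx (is_derive_cst u x u)) _.
    by rewrite dot0r addr0.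
  have H2 := is_derive_mulf Ha Ha.
  (* The squares and differences are rewritten as products and sums, the shapes that the derivative
     rules match. *)
  have -> : nabla_tension u = fun y =>
      (2 * e * (n%:R - 2) * (2 * (conf e y * conf e y) + -1 * conf e y)) *: u
      + (- 4 * e ^+ 2 * (n%:R - 2) * (conf e y * conf e y * dot y u)) *: y.
    by apply/funext => y; apply/rowP => k; rewrite !mxE /=; ring.
  apply: is_derive_eq (is_derive_addf
    (is_derive_scale (is_derive_cmulf (2 * e * (n%:R - 2))
       (is_derive_addf (is_derive_cmulf 2 H2) (is_derive_cmulf (-1) Ha)))
     (is_derive_cst u x u))
    (is_derive_scale (is_derive_cmulf (- 4 * e ^+ 2 * (n%:R - 2))
       (is_derive_mulf H2 Hd)) Hx)) _.
  by apply/rowP => k; rewrite !mxE /=; ring.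
have [_ ->] := Hn.
rewrite Gamma_space_form // /nabla_tension !dotDr !dotZr (dotC u x).
apply/rowP => k; rewrite !mxE; rewrite /conf; field.
by rewrite gt_eqF.
Qed.

Lemma rough_laplacian_identity x : space_form_dom e x ->
  rough_laplacian g h id (tension g h id) x =
  - (2 * e ^+ 2 * (n%:R - 2) *
     ((4 * n%:R - 28) * conf e x ^+ 3 + (16 - 4 * n%:R) * conf e x ^+ 2)) *: x.
Proof.
move=> Dx; rewrite /rough_laplacian trace_flat scaleNr; congr (- _).
under eq_bigr => i _.
  (* The source is flat, so the correction along [nabla_(e_i) e_i] vanishes. *)
  rewrite !pnabla_id [X in _ - X]nabla0 ?nabla_flat // subr0.
  rewrite nabla2_tension_identity // dot_frame dot_framer.
  over.
rewrite -scaler_sumr big_split /=.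
under eq_bigr => i _ do rewrite -scalerA.
rewrite -scaler_sumr sum_frame -scaler_suml big_split /= sumr_const card_ord.
rewrite -mulr_sumr (_ : \sum_i x 0 i ^+ 2 = dot x x); last first.
  by apply: eq_bigr => i _; rewrite expr2.
rewrite -scalerDl scalerA; congr (_ *: _).
rewrite -mulr_natl /conf; field.
by rewrite gt_eqF.
Qed.

(** This is [K (h(v,w) u - h(u,w) v)] with [K = 4 e / c] and [h = c conf^2 ds^2], whence [c]
    disappears. Constant extensions have zero Lie bracket, so only the two iterated derivatives
    contribute. *)
Lemma curvature_space_form x u v w : space_form_dom e x ->
  curvature_at h x u v w =
    (4 * e * conf e x ^+ 2) *: (dot v w *: u - dot u w *: v).
Proof.
move=> Dx; rewrite /curvature_at /curvature.
rewrite [X in _ - X]nabla0 ?subr0; last by rewrite /lie_bracket !derive_cst subrr.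
have H s t y : space_form_dom e y -> nabla h (cst s) (cst t) y =
    (- 2 * e * conf e y) *: (dot y s *: t + dot y t *: s - dot s t *: y).
  by move=> Dy; rewrite nabla_cst Gamma_space_form.
have H2 r s t : nabla h (cst r) (nabla h (cst s) (cst t)) x =
    (4 * e ^+ 2 * conf e x ^+ 2 * dot x r) *:
       (dot x s *: t + dot x t *: s - dot s t *: x)
    + (- 2 * e * conf e x) *: (dot r s *: t + dot r t *: s - dot s t *: r)
    + Gamma h x r ((- 2 * e * conf e x) *:
        (dot x s *: t + dot x t *: s - dot s t *: x)).
  rewrite [LHS]/nabla H //; congr (_ + _).
  rewrite (derive_dom_eq _ (H s t)) //.
  have Hd z : is_derive x r (fun y => dot y z) (dot r z).
    apply: is_derive_eq (is_derive_dot (is_derive_id x r) (is_derive_cst z x r)) _.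
    by rewrite dot0r addr0.
  have [_ ->] := is_derive_scale (is_derive_cmulf (- 2 * e) (is_derive_conf r Dx))
    (is_deriveB
      (is_derive_addf (is_derive_scale (Hd s) (is_derive_cst t x r))
                      (is_derive_scale (Hd t) (is_derive_cst s x r)))
      (is_derive_scale (is_derive_cst (dot s t) x r) (is_derive_id x r))).
  by apply/rowP => k; rewrite !mxE /=; ring.
rewrite !H2 !Gamma_space_form //.
rewrite !(dotDr, dotZr, dotNr) (dotC v u) (dotC u x) (dotC v x).
apply/rowP => k; rewrite !mxE; rewrite /conf; field.
by rewrite gt_eqF.
Qed.

(** The curvature trace is [4 e (1 - n) conf^2] times the tension field. Its [conf^3] term joins
    that of the rough Laplacian through [(n - 7) + (n - 1) = 2 (n - 4)], and [n - 4] becomes a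
    common factor. *)
Lemma bitension_identity x : space_form_dom e x ->
  bitension g h id x =
  (8 * e ^+ 2 * (n%:R - 2) * (n%:R - 4) * conf e x ^+ 2 * (2 * conf e x - 1))
    *: x.
Proof.
move=> Dx; rewrite /bitension rough_laplacian_identity // scaleNr opprK.
rewrite trace_flat.
under eq_bigr => i _.
  rewrite !derive_id curvature_space_form // dot_frame dot_framer scale1r.
  over.
rewrite -scaler_sumr sumrB sum_frame sumr_const card_ord.
rewrite tension_identity // /identity_tension -[_ *: _ *+ n]scaler_nat.
by apply/rowP => k; rewrite !mxE; ring.
Qed.

End bitension_of_identity.

(** * Smoothness of classes closed under differentiation *)

Section smoothness.
Variables (R : realType) (n : nat).
Implicit Types (D : set 'rV[R]_n) (x v : 'rV[R]_n) (f : 'rV[R]_n -> R).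

Lemma smooth_cst (W : normedModType R) D (w : W) : smooth_on D (cst w).
Proof.
move=> k; elim: k w => [|k IH] w; split=> //;
  try by move=> x _; apply: cst_continuous.
move=> i; split=> [x _|]; first exact: derivable_cst.
have -> : 'D_(frame R i) (cst w : 'rV[R]_n -> W) = cst 0; last exact: IH.
by apply/funext => x; rewrite derive_cst.
Qed.

Lemma smooth_id D : smooth_on D id.
Proof.
case=> [|k]; split=> //; try by move=> x _; apply: cvg_id.
move=> i; split=> [x _|]; first exact: derivable_id.
have -> : 'D_(frame R i) id = cst (frame R i); last exact: smooth_cst.
by apply/funext => x; rewrite derive_id.
Qed.

Lemma smooth_of_class (P : ('rV[R]_n -> R) -> Prop) D :
  open D ->
  (forall f x, P f -> D x -> {for x, continuous f}) ->
  (forall f v, P f ->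
     exists2 f', P f' & forall x, D x -> is_derive x v f (f' x)) ->
  forall f, P f -> smooth_on D f.
Proof.
move=> oD PC PD f Pf k.
(* The derivative supplied by the class agrees with the actual one only on [D], so the induction
   must run over all functions that coincide on [D] with a member of the class. *)
suff: forall f1, (forall x, D x -> f x = f1 x) -> Ck D k f1 by apply.
have nearD x (Q : 'rV[R]_n -> Prop) :
    (forall y, D y -> Q y) -> D x -> \forall y \near x, Q y.
  by move=> DQ Dx; apply: filterS (open_nbhs_nbhs (conj oD Dx)).
elim: k => [|k IH] in f Pf * => f1 ff1.
all: have C x : D x -> {for x, continuous f1}.
1,3: move=> Dx; rewrite /prop_for /continuous_at -ff1 //;
     apply: cvg_trans (PC f x Pf Dx);
     apply: (@near_eq_cvg _ _ (nbhs x)); exact: nearD.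
  by split.
split=> // i; have [f' Pf' Df'] := PD f (frame R i) Pf.
have Df1 x : D x -> is_derive x (frame R i) f1 (f' x).
  by move=> Dx; apply: near_eq_is_derive (Df' x Dx); exact: nearD.
split=> [x /Df1[]//|]; apply: IH Pf' _ _ => x /Df1[_ ->] //.
Qed.

End smoothness.

(** * Smooth functions on a space form, and Laplacians of radial functions *)

Section radial.
Variables (R : realType) (n : nat).
Implicit Types (c e k : R) (x u v : 'rV[R]_n).

(** An algebra that contains the test function and is stable under directional derivatives on the
    domain: those of [conf] and of the logarithm are polynomials in [conf] and the coordinates. *)
Inductive rational_log e : ('rV[R]_n -> R) -> Prop :=
| rational_log_cst t : rational_log e (cst t)
| rational_log_coord i : rational_log e (fun x => x 0 i)
| rational_log_conf : rational_log e (conf e)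
| rational_log_ln : rational_log e (fun x => ln (1 + e * dot x x))
| rational_log_add f1 f2 : rational_log e f1 -> rational_log e f2 ->
    rational_log e (fun x => f1 x + f2 x)
| rational_log_mul f1 f2 : rational_log e f1 -> rational_log e f2 ->
    rational_log e (fun x => f1 x * f2 x).

Lemma rational_log_dot e v : rational_log e (fun x => dot x v).
Proof.
rewrite /dot; elim: (index_enum _) => [|i s IH].
  rewrite (_ : (fun _ => _) = cst 0); first exact: rational_log_cst.
  by apply/funext => x; rewrite big_nil.
rewrite (_ : (fun _ => _) = fun x => x 0 i * cst (v 0 i) x
    + \sum_(j <- s) x 0 j * v 0 j); last first.
  by apply/funext => x; rewrite big_cons.
apply: rational_log_add IH; apply: rational_log_mul.
  exact: rational_log_coord.
exact: rational_log_cst.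
Qed.

Lemma is_derive_ln_denom e x v : space_form_dom e x ->
  is_derive x v (fun y => ln (1 + e * dot y y)) (2 * e * conf e x * dot x v).
Proof.
move=> Dx; have D := is_derive_chain (is_derive_sqn x v) (is_derive_affine (dot x x) e).
apply: is_derive_eq (is_derive_chain D (is_derive1_ln Dx)) _.
by rewrite /conf; ring.
Qed.

Lemma differentiable_rational_log e f x :
  rational_log e f -> space_form_dom e x -> differentiable f x.
Proof.
move=> Pf Dx; have Dd : differentiable (fun y : 'rV[R]_n => 1 + e * dot y y) x.
  have -> : (fun y : 'rV[R]_n => 1 + e * dot y y) =
      cst 1 + e *: (fun y => dot y y) by [].
  apply: differentiableD; first exact: differentiable_cst.
  by apply: differentiableZ; exact: differentiable_sqn.
elim: Pf => [t|i|||f1 f2 _ D1 _ D2|f1 f2 _ D1 _ D2].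
- exact: differentiable_cst.
- exact: differentiable_coord.
- by apply: differentiableV => //; rewrite gt_eqF.
- apply: (@differentiable_comp _ _ _ _ _ (@ln R)) => //.
  by apply/derivable1_diffP; case: (is_derive1_ln Dx).
- exact: differentiableD.
- exact: differentiableM.
Qed.

Lemma derive_rational_log e f v : rational_log e f ->
  exists2 f', rational_log e f' &
    forall x, space_form_dom e x -> is_derive x v f (f' x).
Proof.
have dotP := rational_log_dot e v; have confP := rational_log_conf e.
elim=> [t|i|||f1 f2 P1 [d1 Q1 D1] P2 [d2 Q2 D2]|f1 f2 P1 [d1 Q1 D1] P2 [d2 Q2 D2]].
- by exists (cst 0) => [|x _]; [exact: rational_log_cst | exact: is_derive_cst].
- exists (cst (v 0 i)) => [|x _]; first exact: rational_log_cst.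
  exact: is_derive_coord.
- exists (fun x => cst (- 2 * e) x * (conf e x * conf e x) * dot x v).
    do 2![apply: rational_log_mul => //]; first exact: rational_log_cst.
    exact: rational_log_mul.
  by move=> x Dx; apply: is_derive_eq (is_derive_conf v Dx) _; rewrite /cst; ring.
- exists (fun x => cst (2 * e) x * conf e x * dot x v).
    by do 2![apply: rational_log_mul => //]; exact: rational_log_cst.
  by move=> x Dx; apply: is_derive_ln_denom.
- exists (fun x => d1 x + d2 x); first exact: rational_log_add.
  by move=> x Dx; apply: is_derive_addf; [exact: D1 | exact: D2].
- exists (fun x => d1 x * f2 x + f1 x * d2 x).
    by apply: rational_log_add; exact: rational_log_mul.
  by move=> x Dx; apply: is_derive_mulf; [exact: D1 | exact: D2].
Qed.

Lemma smooth_rational_log e f :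
  rational_log e f -> smooth_on (space_form_dom e) f.
Proof.
move=> Pf; apply: (smooth_of_class (P := rational_log e)) Pf => //.
- exact: open_space_form_dom.
- move=> f1 x P1 Dx; apply: differentiable_continuous.
  exact: differentiable_rational_log Dx.
- by move=> f1 v; apply: derive_rational_log.
Qed.

(** For [f = p(|x|^2)] the flat Hessian has trace [4 |x|^2 p2 + 2 n p1], and the Christoffel terms
    add the multiple of [2 - n]. The parameter [e] bounds where [f] is radial and [k] belongs to the
    metric, so a function on the curved domain can also meet the flat Laplacian. As [f] need be
    radial only on the domain, the formula can be iterated. *)
Lemma laplacian_radial c k e (p p1 p2 : R -> R) (f : 'rV[R]_n -> R) x :
    c != 0 ->
    (forall s, 0 < 1 + e * s -> is_derive s 1 p (p1 s)) ->
    (forall s, 0 < 1 + e * s -> is_derive s 1 p1 (p2 s)) ->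
    (forall y, space_form_dom e y -> f y = p (dot y y)) ->
    space_form_dom e x -> space_form_dom k x ->
  laplacian (space_form c k) f x = - (c * conf k x ^+ 2)^-1 *
    (4 * dot x x * p2 (dot x x)
     + (2 * n%:R + 4 * k * conf k x * (2 - n%:R) * dot x x) * p1 (dot x x)).
Proof.
move=> c0 Dp Dp1 fp Dx Kx.
have Df y v : space_form_dom e y ->
    'D_v f y = p1 (dot y y) * (2 * dot y v).
  move=> Dy; rewrite (derive_dom_eq _ fp) //.
  by have [_ ->] := is_derive_chain (is_derive_sqn y v) (Dp _ Dy).
have D2f i : 'D_(frame R i) ('D_(frame R i) f) x =
    4 * p2 (dot x x) * (x 0 i * x 0 i) + 2 * p1 (dot x x).
  rewrite (derive_dom_eq _ (fun y => @Df y (frame R i))) //.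
  have H1 := is_derive_chain (is_derive_sqn x (frame R i)) (Dp1 _ Dx).
  have H2 : is_derive x (frame R i) (fun y => dot y (frame R i)) 1.
    under eq_fun do rewrite dot_framer.
    by apply: is_derive_eq (is_derive_coord _ _ i) _; rewrite mxE !eqxx.
  have [_ ->] := is_derive_mulf H1 (is_derive_cmulf 2 H2).
  by rewrite dot_framer; ring.
rewrite /laplacian (@trace_space_form R n (R^o)) -mulNr; congr (_ * _).
under eq_bigr => i _.
  rewrite D2f nabla_cst Gamma_space_form // Df // dot_frame dot_framer scale1r.
  rewrite dotZr !(dotDr, dotNr, dotZr) dot_framer.
  over.
rewrite sumrB big_split /= -mulr_sumr -/(dot x x) sumr_const card_ord.
pose K := - 4 * k * conf k x * p1 (dot x x).
rewrite (eq_bigr (fun i => 2 * K * (x 0 i * x 0 i) - K * dot x x)) => [|i _].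
  rewrite sumrB -mulr_sumr -/(dot x x) sumr_const card_ord.
  by rewrite -[_ * _ *+ n]mulr_natr -[K * _ *+ n]mulr_natr /K; ring.
by rewrite /K; ring.
Qed.

End radial.

(** * The test function in dimension four *)

Section dimension_four.
Variables (R : realType) (e : R).
Implicit Types (x : 'rV[R]_4) (s : R).

(* Solution of the radial ODE saying that the curved Laplacian is constant. *)
Definition quasi_harmonic x : R := e * dot x x + 2 * ln (1 + e * dot x x).

Let A s := (1 + e * s)^-1.

Lemma smooth_quasi_harmonic : smooth_on (space_form_dom e) quasi_harmonic.
Proof.
apply: smooth_rational_log; apply: rational_log_add; last first.
  apply: (@rational_log_mul _ _ e (cst 2)); first exact: rational_log_cst.
  exact: rational_log_ln.
apply: (@rational_log_mul _ _ e (cst e)); first exact: rational_log_cst.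
have -> : (fun x => dot x x) =
    \sum_i (fun x : 'rV[R]_4 => x 0 i * x 0 i).
  by apply/funext => x; rewrite fct_sumE.
elim/big_ind: _ => [|f1 f2|i _].
- exact: rational_log_cst.
- exact: rational_log_add.
- by apply: rational_log_mul; exact: rational_log_coord.
Qed.

Lemma is_derive_quasi_harmonic s : 0 < 1 + e * s ->
  is_derive s 1 (fun t => e * t + 2 * ln (1 + e * t)) (e * (1 + 2 * A s)).
Proof.
move=> h; have D := is_derive_affine s e.
apply: is_derive_eq (is_derive_addf (is_derive_cmulf e (is_derive_id s 1))
  (is_derive_cmulf 2 (is_derive_chain D (is_derive1_ln h)))) _.
by rewrite /A; ring.
Qed.

Lemma is_derive2_quasi_harmonic s : 0 < 1 + e * s ->
  is_derive s 1 (fun t => e * (1 + 2 * A t)) (- 2 * e ^+ 2 * A s ^+ 2).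
Proof.
move=> h; apply: is_derive_eq (is_derive_cmulf e (is_derive_addf
  (is_derive_cst (1 : R) s 1) (is_derive_cmulf 2 (is_derive_inv h)))) _.
by rewrite /A; ring.
Qed.

(** By [e s A = 1 - A] the bracket of the radial formula collapses to [24 e A^2], and [A^2] cancels
    against the metric factor. *)
Lemma laplacian_quasi_harmonic c x : c != 0 -> space_form_dom e x ->
  laplacian (space_form c e) quasi_harmonic x = - (24 * e / c).
Proof.
move=> c0 Dx; rewrite (laplacian_radial c0 is_derive_quasi_harmonic
  is_derive2_quasi_harmonic _ Dx Dx) // /conf /A; field.
by rewrite c0 gt_eqF.
Qed.

Lemma laplacian2_quasi_harmonic c x : c != 0 -> space_form_dom e x ->
  laplacian (space_form c e) (laplacian (space_form c e) quasi_harmonic) x = 0.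
Proof.
move=> c0 Dx.
rewrite (laplacian_radial (p := cst (- (24 * e / c))) (p1 := cst 0) (p2 := cst 0)
  c0 _ _ _ Dx Dx) => [|y Dy]; first by rewrite /= !mulr0 addr0 mulr0.
exact: laplacian_quasi_harmonic.
Qed.

Lemma flat_bilaplacian_quasi_harmonic :
  laplacian (space_form 1 0) (laplacian (space_form 1 0) quasi_harmonic) 0 =
  - 192 * e ^+ 2.
Proof.
have K y : space_form_dom (0 : R) (y : 'rV[R]_4).
  by rewrite /space_form_dom /= mul0r addr0 ltr01.
have D0 : space_form_dom e (0 : 'rV[R]_4).
  by rewrite /space_form_dom /= dot0r mulr0 addr0 ltr01.
have conf0 y : conf 0 (y : 'rV[R]_4) = 1 by rewrite /conf mul0r addr0 invr1.
have I s (h : 0 < 1 + e * s) : is_derive s 1 A (- e * A s ^+ 2) := is_derive_inv h.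
(* The flat Laplacian of the test function is again radial, with profile [- 8 e (1 + A + A^2)]; [p1]
   and [p2] are its derivatives, by [A' = - e A^2]. At the origin only [- 8 p1(0)] survives, with
   [p1(0) = 24 e^2]. *)
rewrite (laplacian_radial (p := fun s => - 8 * e * (1 + A s + A s * A s))
  (p1 := fun s => 8 * e ^+ 2 * (A s * A s + 2 * (A s * (A s * A s))))
  (p2 := fun s => - 16 * e ^+ 3 * (A s ^+ 3 + 3 * A s ^+ 4))
  (oner_neq0 R) _ _ _ D0 (K 0)).
- by rewrite conf0 dot0r /A !mulr0 !addr0 invr1; field.
- move=> s h; have H := I s h; have H2 := is_derive_mulf H H.
  apply: is_derive_eq (is_derive_cmulf (- 8 * e) (is_derive_addf
    (is_derive_addf (is_derive_cst (1 : R) s 1) H) H2)) _.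
  by ring.
- move=> s h; have H := I s h; have H2 := is_derive_mulf H H.
  apply: is_derive_eq (is_derive_cmulf (8 * e ^+ 2) (is_derive_addf
    H2 (is_derive_cmulf 2 (is_derive_mulf H H2)))) _.
  by ring.
- move=> y Dy; rewrite (laplacian_radial (oner_neq0 R) is_derive_quasi_harmonic
    is_derive2_quasi_harmonic _ Dy (K y)) // conf0 /A; field.
  by rewrite gt_eqF.
Qed.

End dimension_four.

(** * The sphere and the hyperbolic ball as space forms *)

Section models.
Variables (R : realType) (n : nat).
Implicit Types (x u v : 'rV[R]_n) (e : R).

Lemma flat_metricE : cst 1%:M = @space_form R n 1 0.
Proof.
apply/funext => x.
by rewrite /space_form /conf mul0r addr0 invr1 expr1n mulr1.
Qed.

Lemma hyperbolic_metricE :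
  (fun x => (4 / (1 - dot x x) ^+ 2)%:M) = @space_form R n 4 (- 1).
Proof. by apply/funext => x; rewrite /space_form /conf exprVn mulN1r. Qed.

Lemma unit_ballE : @unit_ball R n = space_form_dom (- 1).
Proof.
by apply/funext => x; rewrite /unit_ball /space_form_dom /= mulN1r subr_gt0.
Qed.

Lemma sphere_dom x : space_form_dom 1 x.
Proof. by have := dot_ge0 x; rewrite /space_form_dom /= mul1r; lra. Qed.

Lemma sphere_domE : setT = @space_form_dom R n 1.
Proof. by apply/seteqP; split=> // x _; exact: sphere_dom. Qed.

(** Since [(|x|^2 - 1) / (1 + |x|^2) = 1 - 2 conf], the map is polynomial in [conf] and [x], and its
    derivative follows from that of [conf]. *)
Lemma inv_stereo_conf :
  @inv_stereo R n = fun x => row_mx ((2 * conf 1 x) *: x) (1 - 2 * conf 1 x)%:M.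
Proof.
apply/funext => x; have Dx := sphere_dom x.
rewrite /inv_stereo scale_row_mx scalerA scale_scalar_mx; congr row_mx.
  by rewrite /conf mul1r mulrC.
congr (_%:M); rewrite /conf mul1r; field.
by rewrite -[dot x x]mul1r gt_eqF.
Qed.

Lemma is_derive_row_mx (f : 'rV[R]_n -> 'rV[R]_n) (t : 'rV[R]_n -> R) x v df dt :
  is_derive x v f df -> is_derive x v t dt ->
  is_derive x v (fun y => row_mx (f y) (t y)%:M : 'rV[R]_(n + 1)) (row_mx df dt%:M).
Proof.
move=> [Df <-] Ht; apply: is_derive_row => j.
case: (splitP j) => [i|i] ij.
  have -> : j = lshift 1 i by apply: val_inj.
  under eq_fun do rewrite row_mxEl.
  rewrite row_mxEl derive_mx // mxE; apply: derivableP.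
  by move/derivable_mxP: Df; apply.
have -> : j = rshift n i by apply: val_inj.
under eq_fun do rewrite row_mxEr ord1 mxE eqxx mulr1n.
by rewrite row_mxEr ord1 mxE eqxx mulr1n.
Qed.

Lemma dot_row_mx u v (s t : R) :
  dot (row_mx u s%:M : 'rV[R]_(n + 1)) (row_mx v t%:M) = dot u v + s * t.
Proof.
rewrite /dot big_split_ord /= big_ord1; congr (_ + _).
  by apply: eq_bigr => i _; rewrite !row_mxEl.
by rewrite !row_mxEr !mxE !eqxx !mulr1n.
Qed.

Lemma derive_inv_stereo x v : 'D_v (@inv_stereo R n) x =
  row_mx ((2 * conf 1 x) *: v - (4 * conf 1 x ^+ 2 * dot x v) *: x)
    (4 * conf 1 x ^+ 2 * dot x v)%:M.
Proof.
have Hc := is_derive_cmulf (-2) (is_derive_conf v (sphere_dom x)).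
have H2 := is_derive_cmulf 2 (is_derive_conf v (sphere_dom x)).
rewrite inv_stereo_conf.
have -> : (fun y => row_mx ((2 * conf 1 y) *: y) (1 - 2 * conf 1 y)%:M) =
    fun y : 'rV[R]_n => row_mx ((2 * conf 1 y) *: y) (1 + -2 * conf 1 y)%:M
      :> 'rV[R]_(n + 1).
  by apply/funext => y; rewrite mulNr.
have [_ ->] := is_derive_row_mx (is_derive_scale H2 (is_derive_id x v))
   (is_derive_addf (is_derive_cst (1 : R) x v) Hc).
congr (row_mx _ _%:M); last by ring.
by apply/rowP => k; rewrite !mxE /=; ring.
Qed.

(** The terms in [x_i x_j] coming from the horizontal and the vertical components cancel because
    [conf (1 + |x|^2) = 1]. *)
Lemma sphere_metricE : induced_metric (@inv_stereo R n) = space_form 4 1.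
Proof.
apply/funext => x; have Dx := sphere_dom x.
apply/matrixP => i j; rewrite !mxE !derive_inv_stereo dot_row_mx.
rewrite !(dotDl, dotDr, dotNl, dotNr, dotZl, dotZr) (dotC (frame R i) x).
rewrite !dot_framer [frame R i 0 j]mxE eqxx eq_sym -mulr_natr /conf /=.
by field; rewrite -[dot x x]mul1r gt_eqF.
Qed.

Lemma bitension_identity_eq0 (c e : R) (D : set 'rV[R]_n) : (3 <= n)%N ->
  c != 0 -> e ^+ 2 = 1 -> D = space_form_dom e ->
  (forall x, D x -> bitension (space_form 1 0) (space_form c e) id x = 0) <->
  n = 4.
Proof.
move=> n3 c0 e2 ->; split=> [H|n4 x Dx]; last first.
  have n40 : n%:R - 4 = 0 :> R by rewrite n4 subrr.
  by rewrite bitension_identity // n40 mulr0 !mul0r scale0r.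
pose i0 := Ordinal (ltnW (ltnW n3)).
(* A nonzero point of both domains with [|x|^2 = 1/4]. The factor [2 conf - 1] vanishes only where
   [e |x|^2 = 1], so it is nonzero here, and [n >= 3] excludes [n = 2]; only [n = 4] remains. *)
pose x := 2^-1 *: frame R i0.
have xx : dot x x = 4^-1 by rewrite dotZ dot_frame; field.
have e1 : (e == 1) || (e == - 1) by rewrite -eqf_sqr e2 expr1n.
have Dx : space_form_dom e x.
  by rewrite /space_form_dom /= xx; case/orP: e1 => /eqP ->; lra.
have := H x Dx; rewrite bitension_identity // e2 => /rowP /(_ i0).
rewrite !mxE !eqxx /= => /eqP; rewrite !mulf_eq0 !invr_eq0 !pnatr_eq0 /=.
rewrite !subr_eq0 !eqr_nat (gtn_eqF n3) !orbF.
have dx0 : 1 + e * dot x x != 0 by rewrite gt_eqF.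
have cx1 : (2 * conf e x == 1) = false.
  rewrite /conf -(inj_eq (mulIf dx0)) divfK // mul1r xx.
  by case/orP: e1 => /eqP ->; apply/eqP; lra.
by rewrite (negPf dx0) cx1 !orbF => /eqP.
Qed.

End models.

(** * Failure of the morphism property in dimension four *)

Section not_morphism.
Variable R : realType.

Lemma inv_stereo_not_morphism :
  ~ biharmonic_morphism (euclidean_space R 4) (punctured_sphere R 4)
      (@inv_stereo R 4).
Proof.
move=> [_ _ H].
pose N := punctured_sphere R 4.
(* The test function on the sphere is [quasi_harmonic] read through [stereo]; both its expression in
   the chart and its pullback to Euclidean space are [quasi_harmonic] itself. *)
have FE : (@quasi_harmonic R 1 \o @stereo R 4) \o @inv_stereo R 4 =
    @quasi_harmonic R 1.
  by apply/funext => x /=; rewrite stereoK.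
have UN : open_in N (carrier N) by exists setT; [exact: openT | rewrite setIT].
have ne : carrier (euclidean_space R 4) `&` @inv_stereo R 4 @^-1` carrier N !=set0.
  by exists 0; split=> //; exact: inv_stereo_carrier.
have [|_] := H _ (@quasi_harmonic R 1 \o @stereo R 4) UN ne.
  have DE : dom N `&` param N @^-1` carrier N = space_form_dom 1.
    rewrite -sphere_domE; apply/seteqP; split=> // x _.
    by split=> //; exact: inv_stereo_carrier.
  split.
    by rewrite DE /= FE; exact: smooth_quasi_harmonic.
  move=> x _; rewrite /= FE sphere_metricE.
  apply: laplacian2_quasi_harmonic; last exact: sphere_dom.
  by rewrite pnatr_eq0.
(* A morphism would make the flat bilaplacian vanish at the origin, where it equals [- 192]. *)
move=> /(_ 0); rewrite /= FE flat_metricE flat_bilaplacian_quasi_harmonic.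
rewrite expr1n mulr1 => H0.
suff : (- 192 : R) = 0 by lra.
by apply: H0; split=> //; split=> //; exact: inv_stereo_carrier.
Qed.

Lemma hyperbolic_identity_not_morphism :
  ~ biharmonic_morphism (euclidean_ball R 4) (hyperbolic_ball R 4) (fun x => x).
Proof.
move=> [_ _ H].
pose N := hyperbolic_ball R 4.
have B0 : @unit_ball R 4 0 by rewrite /unit_ball /= dot0r ltr01.
have UN : open_in N (carrier N) by exists setT; [exact: openT | rewrite setIT].
have ne : carrier (euclidean_ball R 4) `&` id @^-1` carrier N !=set0.
  by exists 0.
have [|_] := H _ (@quasi_harmonic R (-1)) UN ne.
  have DE : dom N `&` param N @^-1` carrier N = space_form_dom (- 1).
    by rewrite -unit_ballE; apply/seteqP; split=> // x [].
  split.
    by rewrite DE; exact: smooth_quasi_harmonic.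
  move=> x; rewrite DE /= hyperbolic_metricE => Dx.
  by apply: laplacian2_quasi_harmonic; rewrite ?pnatr_eq0.
move=> /(_ 0); rewrite /= flat_metricE flat_bilaplacian_quasi_harmonic.
rewrite sqrrN expr1n mulr1 => H0.
suff : (- 192 : R) = 0 by lra.
by apply: H0.
Qed.

End not_morphism.

Theorem proposition1 (R : realType) (n : nat) (hn : (3 <= n)%N) :
  (biharmonic_map (euclidean_space R n) (punctured_sphere R n) (@inv_stereo R n)
     <-> n = 4%N) /\
  (biharmonic_map (euclidean_ball R n) (hyperbolic_ball R n) (fun x => x)
     <-> n = 4%N) /\
  (n = 4%N ->
     ~ biharmonic_morphism (euclidean_space R n) (punctured_sphere R n)
         (@inv_stereo R n) /\
     ~ biharmonic_morphism (euclidean_ball R n) (hyperbolic_ball R n)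
         (fun x => x)).
Proof.
have c0 : 4 != 0 :> R by rewrite pnatr_eq0.
split; [|split].
- have E := bitension_identity_eq0 hn c0 (expr1n R 2) (@sphere_domE R n).
  (* In stereographic coordinates the map is the identity, which reduces the claim to the bitension
     of [id]. *)
  have idE : in_coords (euclidean_space R n) (punctured_sphere R n)
      (@inv_stereo R n) = id.
    by apply/funext => x; rewrite /in_coords /= stereoK.
  split=> [[_ _ H]|/E.2 H].
    apply/E.1 => x Dx; have := H x Dx.
    by rewrite idE /= flat_metricE sphere_metricE.
  split.
  - by move=> _ [x _ <-]; exact: inv_stereo_carrier.
  - by rewrite idE; exact: smooth_id.
  - by move=> x Dx; rewrite idE /= flat_metricE sphere_metricE; exact: H.
- have e2 : (- 1) ^+ 2 = 1 :> R by rewrite sqrrN expr1n.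
  have E := bitension_identity_eq0 hn c0 e2 (@unit_ballE R n).
  rewrite -E /biharmonic_map /= flat_metricE hyperbolic_metricE.
  split=> [[_ _ H]//|H]; split=> //; last exact: smooth_id.
  by move=> _ [x Dx <-].
- move=> ->; split; first exact: inv_stereo_not_morphism.
  exact: hyperbolic_identity_not_morphism.
Qed.
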